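(* Let $G$ be a finite group and $p$ a prime number. In each of the following cases the finite spaces $\mathcal{S}_p(G)$ and $\mathcal{A}_p(G)$ have the same homotopy type: (1) $\Omega_1(P)$ is abelian for each $P\in \mathrm{Syl}_p(G)$; (2) $\mathcal{A}_p(G)$ is discrete (i.e. $h(\mathcal{A}_p(G))=0$); (3) $G=D_n$ is a dihedral group; (4) $|G|=p^{\alpha}q$, where $q$ is a prime number. Moreover, the subspace $\mathcal{A}_p(G)\subset\mathcal{S}_p(G)$ is a strong deformation retract if and only if it is a retract, and this happens if and only if condition (1) holds.
   Context: All groups and posets are finite. $\mathcal{S}_p(G)$ is the poset of non-trivial $p$-subgroups of $G$ ordered by inclusion, and $\mathcal{A}_p(G)$ is its subposet of non-trivial elementary abelian $p$-subgroups. $\mathrm{Syl}_p(G)$ is the set of Sylow $p$-subgroups of $G$, and for a group $H$, $\Omega_1(H)$ denotes the subgroup of $H$ generated by its elements of order $p$. $D_n$ denotes the dihedral group of order $2n$. The height $h(X)$ of a poset $X$ is one less than the maximum number of elements in a chain of $X$. A finite poset $X$ is regarded as a finite topological space whose open sets are its down-sets (subsets $U$ such that $x\in U$, $y\le x$ imply $y\in U$). With this topology, continuous maps are exactly order-preserving maps, and two continuous maps $f,g:X\to Y$ are homotopic if and only if there are order-preserving maps $f=f_0,f_1,\ldots,f_m=g:X\to Y$ such that $f_i$ and $f_{i+1}$ are comparable (pointwise) for each $i$. Homotopy type, retract and strong deformation retract are understood for these topological spaces (not for their order complexes). *)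

(* Defs.v *)
From HB Require Import structures.
From mathcomp Require Import all_boot all_order all_fingroup all_solvable.
From mathcomp Require Import all_algebra.
From mathcomp Require Import classical_sets set_interval reals topology normedtype.

Set Implicit Arguments.
Unset Strict Implicit.
Unset Printing Implicit Defensive.

Import Order.TTheory GRing.Theory Num.Theory.
Import numFieldTopology.Exports.

Section SubgroupPosets.
Local Open Scope group_scope.

Record subgroup_poset (gT : finGroupType) (D : {set {group gT}}) : predArgType :=
  SubgroupPoset { subgroup_val :> {group gT}; _ : subgroup_val \in D }.

Section Order.
Variables (gT : finGroupType) (D : {set {group gT}}).

HB.instance Definition _ := [isSub for @subgroup_val gT D].
HB.instance Definition _ := [Finite of subgroup_poset D by <:].

Definition subgroup_le (P Q : subgroup_poset D) : bool := P \subset Q.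

Fact subgroup_le_refl : reflexive subgroup_le.
Proof. by move=> P; apply: subxx. Qed.

Fact subgroup_le_anti : antisymmetric subgroup_le.
Proof.
by move=> P Q /andP[PQ QP]; apply/val_inj/group_inj/eqP; rewrite finset.eqEsubset; apply/andP.
Qed.

Fact subgroup_le_trans : transitive subgroup_le.
Proof. by move=> Q P K PQ QK; apply: fintype.subset_trans QK. Qed.

Fact subgroup_display : Order.disp_t. Proof. exact: Order.Disp tt tt. Qed.

HB.instance Definition _ := Order.Le_isPOrder.Build subgroup_display
  (subgroup_poset D) subgroup_le_refl subgroup_le_anti subgroup_le_trans.

End Order.

Definition nontrivial_psubgroups (gT : finGroupType) (p : nat) (G : {group gT}) :
    {set {group gT}} :=
  [set P : {group gT} | [&& P \subset G, p.-group P & P :!=: 1]].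

Definition nontrivial_pElem (gT : finGroupType) (p : nat) (G : {group gT}) :
    {set {group gT}} :=
  [set E : {group gT} in 'E_p(G) | E :!=: 1].

(* The library's ['D_m] is the dihedral group of order [m] only for even       *)
(* [m >= 4]: its presentation also covers [D_1], cyclic of order 2.           *)
Definition is_dihedral (gT : finGroupType) (n : nat) (G : {group gT}) : Prop :=
  0 < n /\ G \isog Grp (x : y : x ^+ n, y ^+ 2, x ^ y = x^-1).

Lemma is_dihedralE (gT : finGroupType) (n : nat) (G : {group gT}) :
  1 < n -> is_dihedral n G <-> G \isog 'D_(n.*2).
Proof.
move=> n_gt1; have isoD := Grp_dihedral n_gt1; split=> [[_ isoG] | isoGD].
  by rewrite isogEhom isoD (isoGrp_hom isoG) isoG (isoGrp_hom isoD).
by split; [exact: ltnW | exact: isoGrp_trans isoD].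
Qed.

End SubgroupPosets.

Section FiniteSpaces.
Local Open Scope classical_set_scope.
Local Open Scope order_scope.

Definition finite_space (d : Order.disp_t) (X : finPOrderType d) : Type := X.

Section Topology.
Variables (d : Order.disp_t) (X : finPOrderType d).

HB.instance Definition _ := Order.FinPOrder.copy (finite_space X) X.

Definition down_set : set_system (finite_space X) :=
  [set U : set (finite_space X) | forall x y, U x -> y <= x -> U y].

Fact down_setT : down_set setT. Proof. by []. Qed.

Fact down_setI : setI_closed down_set.
Proof.
move=> U V dU dV x y [Ux Vx] yx; split; [exact: dU yx | exact: dV yx].
Qed.

Fact down_set_bigU (I : Type) (f : I -> set (finite_space X)) :
  (forall i, down_set (f i)) -> down_set (\bigcup_i f i).
Proof. by move=> df x y [i _ fx] yx; exists i => //; apply: df yx. Qed.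

HB.instance Definition _ := isOpenTopological.Build (finite_space X)
  down_setT down_setI down_set_bigU.

Lemma open_finite_space (U : set (finite_space X)) :
  open U <-> forall x y, U x -> y <= x -> U y.
Proof. by []. Qed.

End Topology.

Definition chain (d : Order.disp_t) (X : finPOrderType d) (C : {set X}) : bool :=
  [forall x in C, forall y in C, x >=< y].

(* Integer-valued: the empty poset has height -1.                              *)
Definition height (d : Order.disp_t) (X : finPOrderType d) : int :=
  ((\max_(C : {set X} | chain C) #|C|)%N%:Z - 1)%R.

End FiniteSpaces.

Section Homotopy.
Local Open Scope classical_set_scope.
Local Open Scope ring_scope.

Definition is_discrete (X : topologicalType) : Prop := forall U : set X, open U.

Definition homotopic_rel (R : realType) (X Y : topologicalType) (A : set X)
    (f g : X -> Y) : Prop :=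
  exists H : X * R -> Y,
    [/\ {within [set: X] `*` `[0, 1], continuous H},
        forall x, H (x, 0) = f x,
        forall x, H (x, 1) = g x &
        forall a t, A a -> 0 <= t <= 1 -> H (a, t) = f a].

Definition homotopic (R : realType) (X Y : topologicalType) (f g : X -> Y) : Prop :=
  homotopic_rel R set0 f g.

Definition homotopy_equivalent (R : realType) (X Y : topologicalType) : Prop :=
  exists (f : X -> Y) (g : Y -> X),
    [/\ continuous f, continuous g,
        homotopic R (g \o f) idfun & homotopic R (f \o g) idfun].

Definition retraction (X : topologicalType) (A : set X) (r : X -> X) : Prop :=
  [/\ continuous r, forall x, A (r x) & forall a, A a -> r a = a].

Definition retract (X : topologicalType) (A : set X) : Prop :=
  exists r : X -> X, retraction A r.

Definition strong_deformation_retract (R : realType) (X : topologicalType)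
    (A : set X) : Prop :=
  exists2 r : X -> X, retraction A r & homotopic_rel R A idfun r.

End Homotopy.

Definition Sp (gT : finGroupType) (p : nat) (G : {group gT}) :=
  finite_space (subgroup_poset (nontrivial_psubgroups p G)).

Definition Ap (gT : finGroupType) (p : nat) (G : {group gT}) :=
  finite_space (subgroup_poset (nontrivial_pElem p G)).

Definition Ap_in_Sp (gT : finGroupType) (p : nat) (G : {group gT}) : set (Sp p G) :=
  [set P : Sp p G | (P : {group gT}) \in nontrivial_pElem p G]%classic.

Arguments Ap_in_Sp {gT} p G _.

(* Main.v *)
Require Import Defs.
From mathcomp Require Import all_boot all_order all_fingroup all_solvable.
From mathcomp Require Import all_algebra.
From mathcomp Require Import lra.
From mathcomp Require Import classical_sets set_interval reals topology normedtype.

Set Implicit Arguments.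
Unset Strict Implicit.
Unset Printing Implicit Defensive.

Import Order.TTheory GRing.Theory Num.Theory.
Import numFieldTopology.Exports numFieldNormedType.Exports.

(** The topology enters only through two facts about finite spaces.  Continuous
    maps are the monotone maps, and two monotone maps that are comparable
    pointwise are homotopic, by the homotopy that stays at the smaller map
    before time 1 and jumps to the larger one at time 1.  Homotopies can be
    reversed and concatenated, so a zigzag of comparable monotone maps is enough
    to produce a homotopy equivalence.  Nearly all the zigzags below come from
    an assignment [F] of an elementary abelian subgroup to each p-subgroup,
    through [Q <= Q F(Q) >= F(Q)]; this is the content of [joing_equivalence].

    When every ['Ohm_1(P)] is abelian, [F = 'Ohm_1] is a monotone map to the
    elementary abelian subgroups which is the identity on them and lies below
    the identity: it is a strong deformation retraction.  Conversely a
    retraction [r] satisfies [r(P) >= r(E) = E] for every elementary abelian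
    [E <= P], so [r(P)] contains ['Ohm_1(P)], which is therefore abelian.

    When the elementary abelian subgroups form an antichain, every ['Ohm_1(P)] is
    cyclic: if [z] is central of order p in a Sylow subgroup [P], then any
    element [x] of order p in [P] gives an elementary abelian subgroup [<z, x>]
    above [<z>], so [x] lies in [<z>].

    In a dihedral group of order 2n, the Sylow p-subgroups are abelian unless
    p = 2 and n is even; in that case the rotation of order 2 is central, and the
    constant map [F] with value the group it generates contracts both posets.

    In a group of order p^a q, two distinct Sylow p-subgroups always meet in
    [N = 'O_p(G)] ([Sylow_meet_pcore_prime_cofactor]).  So a p-subgroup not
    contained in [N] lies in a unique Sylow subgroup.  If [N = 1], take for [F(Q)]
    the socle of the centre of the Sylow subgroup over [Q]: it is constant on
    comparable subgroups.  If [N <> 1], both posets are contractible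
    ([nontrivial_pcore_equivalence]). *)

(** * Homotopies between monotone maps of finite spaces *)
Section FiniteSpaces.
Local Open Scope classical_set_scope.
Local Open Scope order_scope.

Section Nbhs.
Variables (d : Order.disp_t) (X : finPOrderType d).
Implicit Types x y : finite_space X.

(** The down-set of [x] is its smallest neighbourhood. *)
Lemma nbhs_finite_space x (U : set (finite_space X)) :
  nbhs x U <-> (forall y, y <= x -> U y).
Proof.
split=> [|Ux].
  by rewrite nbhsE => -[V [oV Vx] VU] y yx; apply: VU; apply: oV Vx yx.
rewrite nbhsE; exists [set y | y <= x] => //; split; last exact: lexx.
by move=> y z; rewrite /= => yx zy; apply: le_trans yx.
Qed.
End Nbhs.

Variables (d d' : Order.disp_t) (X : finPOrderType d) (Y : finPOrderType d').

Lemma continuous_homoP (f : finite_space X -> finite_space Y) :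
  continuous f <-> {homo f : x y / x <= y}.
Proof.
split=> [cf x y xy | hf x U /nbhs_finite_space Ufx]; last first.
  by apply/nbhs_finite_space => y yx; apply/Ufx/hf.
have /cf/nbhs_finite_space : nbhs (f y) [set z | z <= f y].
  exact/nbhs_finite_space.
exact.
Qed.

Section Homotopies.
Variable R : realType.
Implicit Types (f g h : finite_space X -> finite_space Y).

Lemma near_continuous (phi : R -> R) (t : R) (P : R -> Prop) :
    {for t, continuous phi} -> (\forall s \near phi t, P s) ->
  \forall s \near t, P (phi s).
Proof. by move=> cphi; apply: cphi. Qed.

(** As the points below [x] form the smallest neighbourhood of [x], continuity
    of a homotopy quantifies over nearby points only in the time variable. *)
Lemma within_continuousP (H : finite_space X * R -> finite_space Y) :
  {within setT `*` `[0%R, 1%R], continuous H} <->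
  forall x (t : R), (0 <= t <= 1)%R ->
    \forall s \near t, (0 <= s <= 1)%R -> forall y, y <= x -> H (y, s) <= H (x, t).
Proof.
split=> [/subspace_continuousP cH x t t01 | nH].
  have /(cH (x, t))[] : nbhs (H (x, t)) [set z | z <= H (x, t)].
    exact/nbhs_finite_space.
  - by split=> //=; rewrite in_itv.
  case=> U V [/= /nbhs_finite_space Ux Vt] UVH.
  apply: filterS Vt => s Vs s01 y yx.
  apply: (UVH (y, s)); first by split=> //; apply: Ux.
  by split=> //=; rewrite in_itv.
apply/subspace_continuousP => -[x t] [_]; rewrite /= in_itv /= => t01 U.
move=> /nbhs_finite_space UH.
exists ([set y | y <= x],
        [set s | (0 <= s <= 1)%R -> forall y, y <= x -> H (y, s) <= H (x, t)]).
  by split=> /=; [apply/nbhs_finite_space | apply: nH].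
case=> y s [/= yx Hs] [_]; rewrite /= in_itv /= => s01.
exact/UH/Hs.
Qed.

(** The jump to the larger map happens at the single closed time 1: values
    at nearby times are smaller, so they stay in any down-set reached at time 1. *)
Lemma homotopic_rel_le (A : set (finite_space X)) f g :
    {homo f : x y / x <= y} -> {homo g : x y / x <= y} ->
    (forall x, f x <= g x) -> (forall a, A a -> g a = f a) ->
  homotopic_rel R A f g.
Proof.
move=> hf hg fg gA; exists (fun z => if (z.2 < 1)%R then f z.1 else g z.1).
split=> [|x|x|a t Aa _] /=; last 3 first.
- by rewrite ltr01.
- by rewrite ltxx.
- by rewrite gA // if_same.
apply/within_continuousP => x t _ /=; case: ifPn => [t1|_].
  by apply: filterS (lt_nbhsl t1) => s s1 _ y yx; rewrite s1 hf.
apply: filterE => s _ y yx; case: ifP => _; last exact: hg.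
exact: le_trans (hf _ _ yx) (fg x).
Qed.

Lemma homotopic_rel_sym (A : set (finite_space X)) f g :
  homotopic_rel R A f g -> homotopic_rel R A g f.
Proof.
case=> H [/within_continuousP cH H0 H1 HA].
exists (fun z => H (z.1, 1 - z.2))%R; split=> [|x|x|a t Aa t01] /=.
- apply/within_continuousP => x t t01 /=.
  have cf : {for t, continuous (fun s : R => 1 - s)%R}.
    by apply: continuousB; [apply: cst_continuous | apply: cvg_id].
  have /(near_continuous cf) := cH x (1 - t)%R ltac:(lra).
  by apply: filterS => s Hs s01; apply: Hs; lra.
- by rewrite subr0.
- by rewrite subrr.
rewrite HA //; last lra.
by rewrite -H1 HA // ler01 lexx.
Qed.

Lemma homotopic_rel_trans (A : set (finite_space X)) f g h :
  homotopic_rel R A f g -> homotopic_rel R A g h -> homotopic_rel R A f h.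
Proof.
case=> H [/within_continuousP cH H0 H1 HA] [K [/within_continuousP cK K0 K1 KA]].
exists (fun z => if z.2 <= 2^-1 then H (z.1, 2 * z.2)
                 else K (z.1, 2 * z.2 - 1))%R.
have gA a : A a -> g a = f a by move=> Aa; rewrite -H1 HA // ler01 lexx.
have c1 (t : R) : {for t, continuous (fun s : R => 2 * s)%R}.
  exact: mulrl_continuous.
have c2 (t : R) : {for t, continuous (fun s : R => 2 * s - 1)%R}.
  by apply: continuousB; [apply: c1 | apply: cst_continuous].
split=> [|x|x|a t Aa t01] /=.
- apply/within_continuousP => x t t01 /=.
  have nH : (t <= 2^-1)%R -> \forall s \near t, (0 <= s <= 2^-1)%R ->
      forall y, y <= x -> H (y, 2 * s)%R <= H (x, 2 * t)%R.
    move=> t2; have /(near_continuous (c1 t)) := cH x (2 * t)%R ltac:(lra).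
    by apply: filterS => s Hs s01; apply: Hs; lra.
  have nK : (2^-1 <= t)%R -> \forall s \near t, (2^-1 <= s <= 1)%R ->
      forall y, y <= x -> K (y, 2 * s - 1)%R <= K (x, 2 * t - 1)%R.
    move=> t2; have /(near_continuous (c2 t)) := cK x (2 * t - 1)%R ltac:(lra).
    by apply: filterS => s Hs s01; apply: Hs; lra.
  case: (ltrgtP t 2^-1%R) => t2.
  + have /nH : (t <= 2^-1)%R by lra.
    apply: filterS2 (lt_nbhsl t2) => s s2 Hs s01 y yx.
    by rewrite (ltW s2) Hs //; lra.
  + have /nK : (2^-1 <= t)%R by lra.
    apply: filterS2 (lt_nbhsr t2) => s s2 Ks s01 y yx.
    by rewrite leNgt s2 /= Ks //; lra.
  (* at the gluing time both halves give the value of the middle map *)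
  have /nH : (t <= 2^-1)%R by lra.
  have /nK : (2^-1 <= t)%R by lra.
  apply: filterS2 => s Ks Hs s01 y yx; case: ifP => s2.
    by rewrite Hs //; lra.
  have -> : H (x, 2 * t)%R = K (x, 2 * t - 1)%R.
    by rewrite t2 divff ?pnatr_eq0 // subrr H1 K0.
  by rewrite Ks //; move/negbT: s2; lra.
- by rewrite invr_ge0 ler0n mulr0 H0.
- by rewrite ifF ?mulr1; [rewrite -addrA subrr addr0 K1 | lra].
by case: ifPn => t2; rewrite ?HA ?KA ?gA //; lra.
Qed.
End Homotopies.
End FiniteSpaces.

Section FenceHomotopies.
Local Open Scope order_scope.
Variables (R : realType) (d d' : Order.disp_t).
Variables (X : finPOrderType d) (Y : finPOrderType d').
Implicit Types f g u : finite_space X -> finite_space Y.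

Lemma homotopic_peak f u g :
    {homo f : x y / x <= y} -> {homo u : x y / x <= y} ->
    {homo g : x y / x <= y} ->
    (forall x, f x <= u x) -> (forall x, g x <= u x) ->
  homotopic R f g.
Proof.
move=> hf hu hg fu gu; apply: (homotopic_rel_trans (g := u)).
  exact: homotopic_rel_le.
by apply: homotopic_rel_sym; apply: homotopic_rel_le.
Qed.

End FenceHomotopies.

(** * Maps between posets of subgroups *)

Section SubgroupMaps.
Import mathcomp.boot.fintype mathcomp.boot.finset.
Local Open Scope group_scope.
Variables (R : realType) (gT : finGroupType).
Implicit Types (D E : {set {group gT}}) (F : {group gT} -> {group gT}).

(** Maps between the posets are handled through their underlying maps on
    subgroups, so that one formula can serve for several domains and ranges. *)
Definition subgroup_map D E F : Prop :=
  {in D, forall P : {group gT}, F P \in E} /\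
  {in D &, forall P Q : {group gT}, P \subset Q -> F P \subset F Q}.

Definition poset_map D E F (mF : subgroup_map D E F)
    (P : finite_space (subgroup_poset D)) : finite_space (subgroup_poset E) :=
  SubgroupPoset (mF.1 _ (valP P)).

Lemma poset_map_homo D E F (mF : subgroup_map D E F) :
  {homo poset_map mF : P Q / (P <= Q)%O}.
Proof. by move=> P Q; apply: mF.2 (valP P) (valP Q). Qed.

Lemma poset_map_homotopic_peak D E F U F' (mF : subgroup_map D E F)
    (mU : subgroup_map D E U) (mF' : subgroup_map D E F') :
    {in D, forall P : {group gT}, F P \subset U P} ->
    {in D, forall P : {group gT}, F' P \subset U P} ->
  homotopic R (poset_map mF) (poset_map mF').
Proof.
move=> FU FU'; apply: (homotopic_peak R (u := poset_map mU)).
- exact: poset_map_homo.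
- exact: poset_map_homo.
- exact: poset_map_homo.
- by move=> P; apply: FU (valP P).
by move=> P; apply: FU' (valP P).
Qed.

Lemma subgroup_map_id D : subgroup_map D D id.
Proof. by split. Qed.

Lemma poset_map_id D (mI : subgroup_map D D id) : poset_map mI = idfun.
Proof. by apply/boolp.funext => P; apply/val_inj. Qed.

(** If [E] is a subset of [D], a map [F : D -> E] homotopic to the identity both
    as a self-map of [D] and as a self-map of [E] is inverse to the inclusion. *)
Lemma poset_map_equivalence D E F (mDE : subgroup_map D E F)
    (mDD : subgroup_map D D F) (mEE : subgroup_map E E F) :
    E \subset D ->
    homotopic R (poset_map (subgroup_map_id D)) (poset_map mDD) ->
    homotopic R (poset_map (subgroup_map_id E)) (poset_map mEE) ->
  homotopy_equivalent R (finite_space (subgroup_poset D))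
                        (finite_space (subgroup_poset E)).
Proof.
rewrite !poset_map_id => /subsetP sED hD hE.
have mI : subgroup_map E D id by split.
exists (poset_map mDE), (poset_map mI); split.
- exact/continuous_homoP/poset_map_homo.
- exact/continuous_homoP/poset_map_homo.
- have -> : poset_map mI \o poset_map mDE = poset_map mDD.
    by apply/boolp.funext => P; apply/val_inj.
  exact: homotopic_rel_sym.
have -> : poset_map mDE \o poset_map mI = poset_map mEE.
  by apply/boolp.funext => P; apply/val_inj.
exact: homotopic_rel_sym.
Qed.

Lemma subgroup_map_joing D F :
    {in D &, forall P Q : {group gT}, P \subset Q -> F P \subset F Q} ->
    {in D, forall P : {group gT}, (P <*> F P)%G \in D} ->
  subgroup_map D D (fun P => P <*> F P)%G.
Proof.
move=> monF DF; split=> // P Q DP DQ sPQ; apply: genS; apply: setUSS => //.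
exact: monF.
Qed.

(** The zigzag [P <= P F(P) >= F(P)], once on [D] and once on [E]. *)
Lemma joing_equivalence D E F :
    E \subset D -> subgroup_map D E F ->
    {in D, forall P : {group gT}, (P <*> F P)%G \in D} ->
    {in E, forall P : {group gT}, (P <*> F P)%G \in E} ->
  homotopy_equivalent R (finite_space (subgroup_poset D))
                        (finite_space (subgroup_poset E)).
Proof.
move=> sED mDE jD jE; have [DE monD] := mDE; have /subsetP sED' := sED.
have mDD : subgroup_map D D F by split=> // P /DE/sED'.
have monE : {in E &, forall P Q : {group gT}, P \subset Q -> F P \subset F Q}.
  by move=> P Q /sED' DP /sED' DQ; apply: monD.
have mEE : subgroup_map E E F by split=> // P /sED'/DE.
apply: (poset_map_equivalence mDE (mDD := mDD) (mEE := mEE) sED).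
  apply: (poset_map_homotopic_peak _ (subgroup_map_joing monD jD)) => P _ /=.
    exact: joing_subl.
  exact: joing_subr.
apply: (poset_map_homotopic_peak _ (subgroup_map_joing monE jE)) => P _ /=.
  exact: joing_subl.
exact: joing_subr.
Qed.

End SubgroupMaps.

(** * Sylow subgroups and elementary abelian subgroups *)

Section Groups.
Import mathcomp.boot.fintype mathcomp.boot.finset.
Local Open Scope group_scope.
Variables (gT : finGroupType) (G : {group gT}) (p : nat).
Hypothesis p_prime : prime p.
Implicit Types E F P Q S A B H : {group gT}.

Lemma mem_nontrivial_psubgroups Q :
  (Q \in nontrivial_psubgroups p G) = [&& Q \subset G, p.-group Q & Q :!=: 1].
Proof. by rewrite inE. Qed.

Lemma mem_nontrivial_pElem E :
  (E \in nontrivial_pElem p G) = [&& E \subset G, p.-abelem E & E :!=: 1].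
Proof. by rewrite !inE -andbA. Qed.

Lemma sub_pElem_psubgroups :
  nontrivial_pElem p G \subset nontrivial_psubgroups p G.
Proof.
apply/subsetP => E; rewrite mem_nontrivial_pElem mem_nontrivial_psubgroups.
by case/and3P=> -> /abelem_pgroup-> ->.
Qed.

Lemma abelem_joing A B :
  p.-abelem A -> p.-abelem B -> B \subset 'C(A) -> p.-abelem (A <*> B).
Proof. by move=> abA abB cAB; rewrite (cprod_abelem p (cprodEY cAB)) abA. Qed.

Lemma pgroup_joing A B :
  p.-group A -> p.-group B -> A \subset 'N(B) -> p.-group (A <*> B).
Proof. by move=> pA pB nBA; rewrite norm_joinEl // pgroupM pA. Qed.

Lemma Ohm1_center_pElem S : S \in nontrivial_psubgroups p G ->
  'Ohm_1('Z(S))%G \in nontrivial_pElem p G.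
Proof.
rewrite mem_nontrivial_psubgroups mem_nontrivial_pElem => /and3P[sSG pS nS].
apply/and3P; split.
- exact: subset_trans (Ohm_sub _ _) (subset_trans (center_sub _) sSG).
- by rewrite Ohm1_abelem ?center_abelian // (pgroupS (center_sub _)).
- by rewrite Ohm1_eq1 center_nil_eq1 // (pgroup_nil pS).
Qed.

Definition abelian_Ohm1_Sylow :=
  forall P, P \in 'Syl_p(G) -> abelian 'Ohm_1(P).

Lemma Ohm1_pElem Q : abelian_Ohm1_Sylow -> Q \in nontrivial_psubgroups p G ->
  'Ohm_1(Q)%G \in nontrivial_pElem p G.
Proof.
rewrite mem_nontrivial_psubgroups mem_nontrivial_pElem => abG /and3P[sQG pQ nQ].
have [P sylP sQP] := Sylow_superset sQG pQ.
rewrite (subset_trans (Ohm_sub _ _) sQG) Ohm1_eq1 nQ andbT /=.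
by rewrite abelem_Ohm1 // (abelianS (OhmS 1 sQP)) ?abG // inE.
Qed.

(** A central element [z] of order p in a Sylow subgroup [P] generates ['Ohm_1(P)],
    since each element of order p in [P] spans with [z] an elementary abelian
    subgroup, which must be [<[z]>]. *)
Lemma antichain_abelian_Ohm1 :
    {in nontrivial_pElem p G &, forall E F, E \subset F -> E :=: F} ->
  abelian_Ohm1_Sylow.
Proof.
move=> antiA P; rewrite inE => sylP; have pP := pHall_pgroup sylP.
have [P1|ntP] := eqVneq (P : {set gT}) 1.
  by rewrite (abelianS (Ohm_sub 1 P)) // P1 abelian1.
have ZP : 'Z(P) != 1 by rewrite center_nil_eq1 // (pgroup_nil pP).
have [_ pZ _] := pgroup_pdiv (pgroupS (center_sub P) pP) ZP.
have [z Zz oz] := Cauchy p_prime pZ.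
have [Pz cPz] := setIP Zz.
have abz : p.-abelem <[z]> by rewrite cycle_abelem ?oz ?dvdnn ?p_prime ?orbT.
have ntz : <[z]> != 1 by rewrite cycle_eq1 -order_gt1 oz prime_gt1.
rewrite (abelianS _ (cycle_abelian z)) // (OhmE 1 pP) gen_subG.
apply/subsetP => x /LdivP[Px xp1]; rewrite expn1 in xp1.
have abx : p.-abelem <[x]> by rewrite cycle_abelem ?p_prime ?orbT // order_dvdn xp1.
have abE : p.-abelem (<[z]> <*> <[x]>)%G.
  apply: abelem_joing => //; rewrite cent_cycle cycle_subG.
  by apply/cent1P; apply: commute_sym; apply: (centP cPz).
have sPG := pHall_sub sylP.
suff eqz : <[z]> = <[z]> <*> <[x]> by rewrite -cycle_subG /= eqz joing_subr.
apply: (antiA <[z]>%G (<[z]> <*> <[x]>)%G); last exact: joing_subl.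
- by rewrite mem_nontrivial_pElem cycle_subG (subsetP sPG) // abz.
rewrite mem_nontrivial_pElem abE (subG1_contra (joing_subl _ _) ntz) andbT.
by rewrite join_subG !cycle_subG !(subsetP sPG).
Qed.

Lemma abelian_Sylow_Ohm1 P :
  p.-Sylow(G) P -> abelian P -> abelian_Ohm1_Sylow.
Proof.
move=> sylP abP Q; rewrite inE => sylQ; have [x _ ->] := Sylow_trans sylP sylQ.
by apply: abelianS (Ohm_sub _ _) _; rewrite abelianJ.
Qed.

(** For odd p a Sylow p-subgroup consists of rotations, and for p = 2 with n odd
    it has order 2.  For p = 2 with n even the half turn is central.  The
    presentation with n = 1 gives the cyclic group of order 2. *)
Lemma dihedral_cases n : is_dihedral n G ->
  abelian_Ohm1_Sylow \/ exists2 Z, Z \in nontrivial_pElem p G & Z \subset 'Z(G).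
Proof.
move=> dG; have [n_gt0 isoG] := dG.
have /existsP[[x y] /= /eqP[defG xn y2 xy]] := isoGrp_hom isoG.
have [P sylP] := Sylow_exists p G.
have [n1|n_neq1] := eqVneq n 1%N.
  left; apply: (abelian_Sylow_Ohm1 sylP); apply: abelianS (pHall_sub sylP) _.
  rewrite -defG; move: xn; rewrite n1 expg1 => ->.
  by rewrite cycle1 joing1G cycle_abelian.
have n_gt1 : 1 < n by rewrite ltn_neqAle eq_sym n_neq1.
have oG : #|G| = n.*2.
  have /(is_dihedralE _ n_gt1)/card_isog -> := dG.
  exact: card_dihedral.
have nxy : <[y]> \subset 'N(<[x]>).
  by rewrite cycle_subG; apply/normP; rewrite -cycleJ xy cycleV.
have ox : #[x] = n.
  have xdvd : #[x] %| n by rewrite order_dvdn xn.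
  have ydvd : #[y] %| 2 by rewrite order_dvdn y2.
  have : #|G| <= #[x] * #[y].
    rewrite -defG joingC norm_joinEl // mulnC /order mul_cardG.
    exact: leq_pmulr (cardG_gt0 _).
  rewrite oG -muln2 => le; apply/eqP; rewrite eqn_leq dvdn_leq //=.
  rewrite -(leq_pmul2r (isT : 0 < 2)); apply: leq_trans le _.
  by rewrite leq_mul2l dvdn_leq ?orbT.
have [p2|p_neq2] := eqVneq p 2; last first.
  (* the order of G is 2n, so a Sylow subgroup of the rotations is one of G *)
  left; have [Q sylQ] := Sylow_exists p <[x]>.
  apply: (abelian_Sylow_Ohm1 (P := Q)); last first.
    exact: abelianS (pHall_sub sylQ) (cycle_abelian x).
  rewrite pHallE (subset_trans (pHall_sub sylQ)) /=; last first.
    by rewrite -defG joing_subl.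
  rewrite (card_Hall sylQ) -[#|<[x]>|]/#[x] ox oG -muln2 partnM //.
  by rewrite (part_p'nat (n := 2)) ?muln1 // p'natE // dvdn_prime2.
have [n_odd|n_even] := boolP (odd n).
  left; apply: (abelian_Sylow_Ohm1 sylP); apply: p2group_abelian (pHall_pgroup sylP) _.
  rewrite (card_Hall sylP) oG p2 p_part pfactorK // -muln2 lognM //.
  by rewrite (@lognE 2 n) dvdn2 n_odd andbF.
right; exists <[x ^+ n./2]>%G.
  have oz : #[x ^+ n./2] = p.
    rewrite orderXdiv ox; last by rewrite -[X in _ %| X]even_halfK // -muln2 dvdn_mulr.
    rewrite p2 -[X in X %/ _]even_halfK // -muln2 mulKn //.
    by rewrite half_gt0.
  rewrite mem_nontrivial_pElem cycle_subG groupX -?defG ?mem_gen ?inE ?cycle_id //=.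
  rewrite cycle_abelem ?oz ?dvdnn ?p_prime ?orbT //=.
  by rewrite cycle_eq1 -order_gt1 oz prime_gt1.
have z2 : (x ^+ n./2) ^+ 2 = 1 by rewrite -expgM muln2 even_halfK.
rewrite cycle_subG inE groupX -?defG ?mem_gen ?inE ?cycle_id //=.
rewrite centY !inE !cent_cycle; apply/andP; split; apply/cent1P.
  by apply: commute_sym; apply: commuteX.
apply/commgP/conjg_fixP.
by rewrite conjXg xy expgVn; apply/eqP; rewrite eq_invg_mul -z2.
Qed.

Lemma sub_pcore H : H \subset G ->
  (forall P, p.-Sylow(G) P -> H \subset P) -> H \subset 'O_p(G).
Proof.
by move=> sHG sHP; apply/bigcapsP => P; rewrite max_pgroup_Sylow => /sHP.
Qed.

Definition Sylow_meet_pcore :=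
  forall P Q, p.-Sylow(G) P -> p.-Sylow(G) Q -> P :!=: Q -> P :&: Q = 'O_p(G).

Lemma Sylow_sub_eq P Q : p.-Sylow(G) P -> p.-Sylow(G) Q -> P \subset Q -> P :=: Q.
Proof.
by move=> sP sQ PQ; apply/eqP; rewrite eqEcard PQ (card_Hall sP) (card_Hall sQ) /=.
Qed.

(** By downward induction on the order of [I = P :&: Q], the intersection [I] lies
    in every Sylow p-subgroup.  If ['N_G(I)] is a p-group, it lies in a Sylow
    subgroup [U] which meets [P] or [Q] in more than [I], because normalisers
    grow in p-groups; the induction hypothesis then enlarges [I], which is
    absurd.  Otherwise q divides the order of ['N_G(I)], which thus contains a
    subgroup [K] of order q; then [G = P K], so every Sylow subgroup is a
    conjugate of [P] by an element of [K], and contains [I] as [P] does. *)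
Lemma Sylow_meet_pcore_prime_cofactor alpha q :
  prime q -> #|G| = (p ^ alpha * q)%N -> Sylow_meet_pcore.
Proof.
move=> q_prime oG.
suff meet P Q (T : {group gT}) : p.-Sylow(G) P -> p.-Sylow(G) Q -> p.-Sylow(G) T ->
    P :!=: Q -> P :&: Q \subset T.
  move=> P Q sylP sylQ nPQ; apply/eqP; rewrite eqEsubset.
  rewrite subsetI !pcore_sub_Hall // andbT sub_pcore //.
    by rewrite subIset // (pHall_sub sylP).
  by move=> T sylT; apply: meet.
have [k] := ubnP (#|G| - #|P :&: Q|).
elim: k => // k IHk in P Q T * => lek sylP sylQ sylT nPQ.
set I := P :&: Q.
have sIP : I \subset P := subsetIl P Q.
have sIQ : I \subset Q := subsetIr P Q.
have [pN|] := boolP (p.-group 'N_G(I)).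
  have [U sylU sNU] := Sylow_superset (subsetIl G _) pN.
  (* used for A the one of P and Q that differs from U, and B the other *)
  have absurd A B : p.-Sylow(G) A -> p.-Sylow(G) B -> A :&: B = I ->
      A :!=: U -> A :!=: B -> False.
    move=> sylA sylB defI nAU nAB.
    have sAG := pHall_sub sylA.
    have pr : I \proper A.
      rewrite -defI properEneq subsetIl andbT; apply: contra nAB => /eqP/setIidPl sAB.
      by apply/eqP/Sylow_sub_eq.
    have ltI : I \proper 'N_A(I).
      exact: nilpotent_proper_norm (pgroup_nil (pHall_pgroup sylA)) pr.
    have sNAU : 'N_A(I) \subset A :&: U.
      by rewrite subsetI subsetIl (subset_trans (setSI _ sAG) sNU).
    have ltIU : I \proper A :&: U := proper_sub_trans ltI sNAU.
    have : A :&: U \subset B.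
      apply: IHk => //; rewrite -ltnS (leq_trans _ lek) // ltnS.
      apply: ltn_sub2l (proper_card ltIU); apply: proper_card.
      exact: proper_sub_trans pr sAG.
    move=> sAUB; move: ltI; rewrite properE => /andP[_ /negP]; apply.
    rewrite -{2}defI subsetI subsetIl.
    exact: subset_trans sNAU sAUB.
  have [eqPU|] := eqVneq (P : {set gT}) U; last by move/(absurd P Q); case.
  case: (absurd Q P) => //; first exact: setIC.
    by rewrite -eqPU eq_sym.
  by rewrite eq_sym.
rewrite /pgroup /pnat cardG_gt0 => /allPn[r]; rewrite mem_primes.
case/and3P => r_prime _ rN /= r_neqp.
have {}r_neqp : r != p by [].
have rq : r = q.
  have : r %| #|G| := dvdn_trans rN (cardSg (subsetIl _ _)).
  rewrite oG Euclid_dvdM // Euclid_dvdX // !dvdn_prime2 //.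
  by rewrite (negPf r_neqp) /= => /eqP.
move: r_neqp rN; rewrite {}rq => q_neqp qN {r r_prime}.
have [x /setIP[Gx nIx] ox] := Cauchy q_prime qN.
have oP : #|P| = (p ^ alpha)%N.
  rewrite (card_Hall sylP) oG partnM ?expn_gt0 ?prime_gt0 //.
  rewrite part_pnat_id ?pnatX ?pnat_id // (part_p'nat (n := q)) ?muln1 //.
  by rewrite p'natE // dvdn_prime2 // eq_sym.
have defG : P * <[x]> = G.
  apply/eqP; rewrite eqEcard mul_subG ?cycle_subG ?(pHall_sub sylP) //=.
  rewrite coprime_cardMg -[#|<[x]>|]/#[x] ox oP ?oG // coprimeXl //.
  by rewrite prime_coprime // dvdn_prime2 // eq_sym.
have [g] := Sylow_trans sylP sylT; rewrite -defG => /mulsgP[a b Pa xb ->] ->.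
have nIb : b \in 'N(I) by apply: subsetP xb; rewrite cycle_subG.
by rewrite conjsgM conjGid // -(normP nIb) conjSg.
Qed.
End Groups.

(** * The equivalences *)

Section Equivalences.
Import mathcomp.boot.fintype mathcomp.boot.finset.
Local Open Scope group_scope.
Variables (R : realType) (gT : finGroupType) (G : {group gT}) (p : nat).
Hypothesis p_prime : prime p.
Implicit Types E F P Q S A B H : {group gT}.

Local Notation psubs := (nontrivial_psubgroups p G).
Local Notation pelems := (nontrivial_pElem p G).

Lemma pElem_psubgroup E : E \in pelems -> E \in psubs.
Proof. exact/subsetP/sub_pElem_psubgroups. Qed.

Lemma Ohm1_map : abelian_Ohm1_Sylow G p ->
  subgroup_map (psubs) (pelems) (fun Q => 'Ohm_1(Q))%G.
Proof.
move=> abG; split=> [Q DQ | Q Q' _ _ sQQ']; first exact: Ohm1_pElem.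
exact: OhmS.
Qed.

(** Here [Q 'Ohm_1(Q) = Q], so the zigzag reduces to ['Ohm_1(Q) <= Q]. *)
Lemma abelian_Ohm1_equivalence :
  abelian_Ohm1_Sylow G p -> homotopy_equivalent R (Sp p G) (Ap p G).
Proof.
move=> abG; have joinOhm Q : (Q <*> 'Ohm_1(Q))%G = Q.
  by apply/group_inj/joing_idPl/Ohm_sub.
apply: joing_equivalence _ (Ohm1_map abG) _ _ => [|Q|Q].
- exact: sub_pElem_psubgroups.
- by rewrite joinOhm.
by rewrite joinOhm.
Qed.

(** The constant map with value [Z] contracts both posets. *)
Lemma central_equivalence Z : Z \in pelems -> Z \subset 'Z(G) ->
  homotopy_equivalent R (Sp p G) (Ap p G).
Proof.
move=> AZ; rewrite subsetI => /andP[sZG cGZ].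
have /and3P[_ abZ ntZ] : [&& Z \subset G, p.-abelem Z & Z :!=: 1].
  by rewrite -mem_nontrivial_pElem.
have cZ Q : Q \subset G -> Z \subset 'C(Q).
  by move=> sQG; apply: subset_trans cGZ (centS sQG).
apply: (joing_equivalence R (F := fun=> Z)) => [||Q|Q].
- exact: sub_pElem_psubgroups.
- by split.
- rewrite !mem_nontrivial_psubgroups => /and3P[sQG pQ ntQ].
  rewrite join_subG sQG sZG (subG1_contra (joing_subl _ _) ntQ) andbT /=.
  by rewrite pgroup_joing ?(abelem_pgroup abZ) // cents_norm // centsC cZ.
rewrite !mem_nontrivial_pElem => /and3P[sQG abQ ntQ].
rewrite join_subG sQG sZG (subG1_contra (joing_subl _ _) ntQ) andbT /=.
by rewrite abelem_joing ?cZ.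
Qed.

Section SylowOver.
Hypothesis meetG : Sylow_meet_pcore G p.

(** The default [G] is never taken on p-subgroups. *)
Definition Sylow_over Q : {group gT} :=
  odflt G [pick P : {group gT} | p.-Sylow(G) P && (Q \subset P)].

Lemma Sylow_overP Q : Q \in psubs ->
  p.-Sylow(G) (Sylow_over Q) /\ Q \subset Sylow_over Q.
Proof.
rewrite mem_nontrivial_psubgroups => /and3P[sQG pQ _]; rewrite /Sylow_over.
case: pickP => [P /andP[]|noP] //=.
have [P sylP sQP] := Sylow_superset sQG pQ.
by have := noP P; rewrite sylP sQP.
Qed.

Lemma Sylow_over_psubgroup Q : Q \in psubs ->
  Sylow_over Q \in psubs.
Proof.
move=> DQ; have [sylS sQS] := Sylow_overP DQ; move: DQ.
rewrite !mem_nontrivial_psubgroups => /and3P[_ _ ntQ].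
by rewrite (pHall_sub sylS) (pHall_pgroup sylS) (subG1_contra sQS).
Qed.

Lemma Sylow_over_eq Q Q' :
    Q \in psubs -> Q' \in psubs ->
    ~~ (Q \subset 'O_p(G)) -> Q \subset Q' ->
  Sylow_over Q :=: Sylow_over Q'.
Proof.
move=> DQ DQ' nQO sQQ'; apply/eqP; apply: contraR nQO => neq.
have [sylS sQS] := Sylow_overP DQ; have [sylS' sQS'] := Sylow_overP DQ'.
by rewrite -(meetG sylS sylS' neq) subsetI sQS (subset_trans sQQ').
Qed.

Lemma trivial_pcore_equivalence :
  'O_p(G) = 1 -> homotopy_equivalent R (Sp p G) (Ap p G).
Proof.
move=> O1; pose F Q := 'Ohm_1('Z(Sylow_over Q))%G.
have FA Q : Q \in psubs -> F Q \in pelems.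
  by move=> DQ; apply/Ohm1_center_pElem/Sylow_over_psubgroup.
have cF Q : F Q \subset 'Z(Sylow_over Q) by apply: Ohm_sub.
apply: (joing_equivalence R (F := F)) => [||Q DQ|E AE].
- exact: sub_pElem_psubgroups.
- split=> // Q Q' DQ DQ' sQQ'; rewrite /F /= (Sylow_over_eq DQ DQ') //.
  rewrite O1 subG1; move: DQ; rewrite mem_nontrivial_psubgroups.
  by case/and3P.
- have [sylS sQS] := Sylow_overP DQ.
  have sjS : Q <*> F Q \subset Sylow_over Q.
    by rewrite join_subG sQS (subset_trans (cF Q)) ?center_sub.
  move: DQ; rewrite !mem_nontrivial_psubgroups => /and3P[_ _ ntQ].
  rewrite (subset_trans sjS) ?(pHall_sub sylS) //=.
  by rewrite (pgroupS sjS (pHall_pgroup sylS)) (subG1_contra (joing_subl _ _)).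
have DE := pElem_psubgroup AE; have [sylS sES] := Sylow_overP DE.
move: (FA E DE) AE; rewrite !mem_nontrivial_pElem.
move=> /and3P[sFG abF _] /and3P[sEG abE ntE].
rewrite join_subG sEG sFG (subG1_contra (joing_subl _ _) ntE) andbT /=.
rewrite abelem_joing // (subset_trans (cF E)) // (subset_trans (subsetIr _ _)) //.
exact: centS.
Qed.

(** Let [N = 'O_p(G)], [A = 'Ohm_1('Z(N))] and, for [E] in the Sylow subgroup [S],
    let [W(E) = 'Ohm_1(N :&: 'Z(S))].  All p-subgroups contract to [A] through
    [Q <= Q N >= A].  An elementary abelian [E] need not have [E N] elementary abelian, so
    there [E] is first enlarged by [W(E)], so that it meets [N], then cut down
    to [N], and then enlarged by [A], which is central in [N]. *)
Lemma nontrivial_pcore_equivalence :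
  'O_p(G) != 1 -> homotopy_equivalent R (Sp p G) (Ap p G).
Proof.
move=> ntN; set N := 'O_p(G)%G.
have sNG : N \subset G := pcore_sub p G.
have pN : p.-group N := pcore_pgroup p G.
have DN : N \in psubs.
  by rewrite mem_nontrivial_psubgroups sNG pN.
pose A := 'Ohm_1('Z(N))%G.
have AA : A \in pelems := Ohm1_center_pElem DN.
have sAZ : A \subset 'Z(N) := Ohm_sub 1 _.
have sAN : A \subset N := subset_trans sAZ (center_sub N).
have cNA : A \subset 'C(N) := subset_trans sAZ (subsetIr _ _).
have abA : p.-abelem A by move: AA; rewrite mem_nontrivial_pElem => /and3P[].
have ntA : A :!=: 1 by move: AA; rewrite mem_nontrivial_pElem => /and3P[].
pose W E := 'Ohm_1(N :&: 'Z(Sylow_over E))%G.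
have WP E : E \in psubs ->
    [/\ W E \subset N, p.-abelem (W E), W E :!=: 1 & W E \subset 'C(E)].
  move=> DE; have [sylS sES] := Sylow_overP DE; have pS := pHall_pgroup sylS.
  have sW : W E \subset N :&: 'Z(Sylow_over E) := Ohm_sub 1 _.
  split.
  - exact: subset_trans sW (subsetIl _ _).
  - apply: Ohm1_abelem; first exact: pgroupS (subsetIl _ _) pN.
    exact: abelianS (subsetIr _ _) (center_abelian _).
  - rewrite Ohm1_eq1 meet_center_nil ?(pgroup_nil pS) //.
    exact: normalS (pcore_sub_Hall sylS) (pHall_sub sylS) (pcore_normal p G).
  apply: subset_trans sW (subset_trans (subsetIr _ _) _).
  exact: subset_trans (subsetIr _ _) (centS sES).
(* Subgroups of N lie in several Sylow subgroups, so a factor W(E) would not be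
   monotone on them. *)
pose F1 E := if E \subset N then E else (E <*> W E)%G.
pose F2 E := (F1 E :&: N)%G.
pose F3 E := (F2 E <*> A)%G.
have sF1 E : E \subset F1 E.
  by rewrite /F1; case: ifP => // _; apply: joing_subl.
have map1 : subgroup_map (pelems) (pelems) F1.
  split=> [E AE | E E' AE AE' sEE'].
    rewrite /F1; case: ifP => // _; have [sWN abW _ cW] := WP _ (pElem_psubgroup AE).
    move: AE; rewrite !mem_nontrivial_pElem => /and3P[sEG abE ntE].
    rewrite join_subG sEG (subset_trans sWN) // abelem_joing //.
    by rewrite (subG1_contra (joing_subl _ _)).
  rewrite {1}/F1; case: ifPn => [_|nEN]; first exact: subset_trans (sF1 E').
  rewrite /F1 ifN; last by apply: contra nEN; apply: subset_trans.
  have eqS := Sylow_over_eq (pElem_psubgroup AE) (pElem_psubgroup AE') nEN sEE'.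
  rewrite /W (group_inj eqS).
  exact: genS (setSU _ sEE').
have map2 : subgroup_map (pelems) (pelems) F2.
  split=> [E AE | E E' AE AE' sEE']; last exact/setSI/(map1.2).
  have := map1.1 _ AE; rewrite !mem_nontrivial_pElem => /and3P[sFG abF _].
  rewrite (subset_trans (subsetIl _ _)) // (abelemS (subsetIl _ _)) //=.
  rewrite /F1; case: ifPn => [sEN|_].
    move: AE; rewrite mem_nontrivial_pElem => /and3P[_ _].
    by rewrite (setIidPl sEN).
  have [sWN _ ntW _] := WP _ (pElem_psubgroup AE).
  by rewrite (subG1_contra _ ntW) // subsetI joing_subr.
have map3 : subgroup_map (pelems) (pelems) F3.
  split=> [E AE | E E' AE AE' sEE']; last exact: genS (setSU _ (map2.2 _ _ AE AE' sEE')).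
  have := map2.1 _ AE; rewrite !mem_nontrivial_pElem => /and3P[sFG abF _].
  rewrite join_subG sFG (subset_trans sAN) //= (subG1_contra (joing_subr _ _) ntA) andbT.
  by rewrite abelem_joing // (subset_trans cNA) // centS // subsetIr.
have mapA (D : {set {group gT}}) : subgroup_map D (pelems) (fun=> A) by split.
have mapAD : subgroup_map (psubs) (psubs) (fun=> A).
  by split=> // _ _; apply: pElem_psubgroup.
apply: (@poset_map_equivalence R _ _ _ _ (mapA psubs) mapAD (mapA pelems)).
- exact: sub_pElem_psubgroups.
- have mapN : subgroup_map (psubs) (psubs)
      (fun Q => Q <*> N)%G.
    apply: (subgroup_map_joing (F := fun=> N)) => // Q.
    rewrite !mem_nontrivial_psubgroups => /and3P[sQG pQ ntQ].
    rewrite join_subG sQG sNG (subG1_contra (joing_subl _ _) ntQ) andbT /=.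
    by rewrite pgroup_joing // (subset_trans sQG) // gFnorm.
  apply: (poset_map_homotopic_peak R _ mapN) => Q _ /=; first exact: joing_subl.
  exact: subset_trans sAN (joing_subr _ _).
apply: (homotopic_rel_trans (g := poset_map map2)).
  by apply: (poset_map_homotopic_peak R _ map1) => E _ //=; apply: subsetIl.
apply: (poset_map_homotopic_peak R _ map3) => E _ /=; first exact: joing_subl.
exact: joing_subr.
Qed.

End SylowOver.

Lemma antichain_pElem : is_discrete (Ap p G) \/ height (Ap p G) = 0%R ->
  {in pelems &, forall E F, E \subset F -> E :=: F}.
Proof.
move=> discA E F AE AF sEF.
pose e : Ap p G := SubgroupPoset AE; pose f : Ap p G := SubgroupPoset AF.
have le_ef : (e <= f)%O := sEF.
suff fe : (f <= e)%O by apply/eqP; rewrite eqEsubset sEF; exact: fe.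
case: discA => [/(_ [set x | x = f]%classic) oF | h0].
  by rewrite (oF f e erefl le_ef).
apply: contraT => nfe.
have ch : @chain _ (Ap p G) [set e; f].
  apply/'forall_implyP => x; rewrite !inE => Hx.
  apply/'forall_implyP => y; rewrite !inE => Hy.
  case/orP: Hx => /eqP->; case/orP: Hy => /eqP->;
    by rewrite /Order.comparable ?lexx ?le_ef ?orbT.
have := leq_bigmax_cond (P := @chain _ (Ap p G)) (F := fun C : {set Ap p G} => #|C|) _ ch.
have -> : (\max_(C : {set Ap p G} | chain C) #|C| = 1)%N.
  by move/eqP: h0; rewrite /height subr_eq0 => /eqP[].
have nef : e != f by apply: contraNneq nfe => ->.
by rewrite cards2 nef.
Qed.

(** The image of a Sylow subgroup [P] contains every elementary abelian subgroup
    of [P], by monotonicity. *)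
Lemma retract_abelian_Ohm1 : retract (Ap_in_Sp p G) -> abelian_Ohm1_Sylow G p.
Proof.
case=> r [/continuous_homoP r_homo rA rid] P; rewrite inE => sylP.
have pP := pHall_pgroup sylP; have sPG := pHall_sub sylP.
have [P1|ntP] := eqVneq (P : {set gT}) 1.
  by rewrite (abelianS (Ohm_sub 1 P)) // P1 abelian1.
have DP : P \in psubs.
  by rewrite mem_nontrivial_psubgroups sPG pP.
pose P' : Sp p G := SubgroupPoset DP.
have := rA P'; rewrite /Ap_in_Sp /= mem_nontrivial_pElem => /and3P[_ abr _].
apply: abelianS (abelem_abelian abr); rewrite (OhmE 1 pP) gen_subG.
apply/subsetP => x /LdivP[Px]; rewrite expn1 => xp1.
have [->|ntx] := eqVneq x 1; first exact: group1.
have Ax : <[x]>%G \in pelems.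
  rewrite mem_nontrivial_pElem cycle_subG (subsetP sPG) // cycle_eq1 ntx andbT.
  by rewrite cycle_abelem ?p_prime ?orbT //= order_dvdn xp1.
pose x' : Sp p G := SubgroupPoset (pElem_psubgroup Ax).
have : (r x' <= r P')%O by apply: r_homo; rewrite /Order.le /= /subgroup_le cycle_subG.
by rewrite rid // => sxr; rewrite -cycle_subG; exact: sxr.
Qed.

Lemma abelian_Ohm1_strong_retract :
  abelian_Ohm1_Sylow G p -> strong_deformation_retract R (Ap_in_Sp p G).
Proof.
move=> abG; have [OA monO] := Ohm1_map abG.
have mO : subgroup_map (psubs) (psubs)
    (fun Q => 'Ohm_1(Q))%G.
  by split=> // Q /OA; apply: pElem_psubgroup.
have rid (a : Sp p G) : Ap_in_Sp p G a -> poset_map mO a = a.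
  move=> Aa; apply/val_inj/group_inj => /=; apply: (@Ohm1_id _ p).
  by move: Aa; rewrite /Ap_in_Sp /= mem_nontrivial_pElem => /and3P[].
exists (poset_map mO).
  split=> //; first exact/continuous_homoP/poset_map_homo.
  by move=> Q; apply: OA (valP Q).
apply: homotopic_rel_sym; apply: homotopic_rel_le => //; first exact: poset_map_homo.
- by move=> Q; apply: Ohm_sub.
by move=> a /rid.
Qed.

End Equivalences.

Theorem proposition3p2 (R : realType) (gT : finGroupType) (G : {group gT})
    (p : nat) (p_prime : prime p) :
  [/\ (forall P : {group gT}, P \in ('Syl_p(G))%g -> abelian ('Ohm_1(P))%g) ->
        homotopy_equivalent R (Sp p G) (Ap p G),
      is_discrete (Ap p G) \/ height (Ap p G) = 0%R ->
        homotopy_equivalent R (Sp p G) (Ap p G),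
      (exists n : nat, is_dihedral n G) ->
        homotopy_equivalent R (Sp p G) (Ap p G) &
      (exists (alpha q : nat), prime q /\ #|G| = (p ^ alpha * q)%N) ->
        homotopy_equivalent R (Sp p G) (Ap p G)] /\
  (strong_deformation_retract R (Ap_in_Sp p G) <-> retract (Ap_in_Sp p G)) /\
  (retract (Ap_in_Sp p G) <->
    forall P : {group gT}, P \in ('Syl_p(G))%g -> abelian ('Ohm_1(P))%g).

Proof.
have strong_retract := @abelian_Ohm1_strong_retract R gT G p.
have retract_abelian := @retract_abelian_Ohm1 gT G p p_prime.
split; [split | split; split].
- exact: abelian_Ohm1_equivalence.
- move/antichain_pElem/(antichain_abelian_Ohm1 p_prime).
  exact: abelian_Ohm1_equivalence.
- case=> n /(dihedral_cases p_prime)[|[Z AZ cZ]].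
    exact: abelian_Ohm1_equivalence.
  exact: central_equivalence AZ cZ.
- case=> alpha [q [q_prime oG]].
  have meetG := Sylow_meet_pcore_prime_cofactor p_prime q_prime oG.
  have [O1|ntO] := eqVneq ('O_p(G))%g 1%g.
    exact: trivial_pcore_equivalence.
  exact: nontrivial_pcore_equivalence.
- by case=> r rA _; exists r.
- by move/retract_abelian/strong_retract.
- exact: retract_abelian.
- by move/strong_retract => -[r rA _]; exists r.
Qed.
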